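(* Let $\mathcal{N}$ be a connected algebraic tensor network of carving width $w$ and algebraic degree $d$ computing a function $f:\{0,1\}^{Y}\to\{0,1\}$. Let $l\ge |Y|$ be the number of $Y$-tensors in $\mathcal{N}$. Then $f$ can be computed by an algebraic tensor network $\mathcal{N}'$ of size at most $4l(w+1)$, rank at most $2w$, and algebraic degree $d$.
   Context: Let $\Pi=\{|0\rangle\langle0|,|0\rangle\langle1|,|1\rangle\langle0|,|1\rangle\langle1|\}$. An algebraic tensor over a variable set $Y$ with index set $\mathcal{I}=\{i_1,\dots,i_k\}$ (positive integers) is an array indexed by $\Pi^k$ with entries in $\mathbb{C}[Y]$; rank $=|\mathcal{I}|$, algebraic degree $=$ max degree of an entry. It is a $Y$-tensor if some entry has a nonzero term containing a variable of $Y$. An algebraic tensor network $\mathcal{N}=[g_1,\dots,g_m]$ is a sequence of such tensors in which every occurring index lies in exactly two index sets; size $=m$, rank $=\max$ rank, algebraic degree $=\max$ degree. $G(\mathcal{N})$: vertex per tensor, edge per index joining the two tensors containing it (multigraph); connectedness of $\mathcal{N}$ refers to $G(\mathcal{N})$. Contracting $g,g'$ sums the product of entries over $\Pi$-values of shared indices, yielding a tensor on the symmetric difference of index sets; contracting all tensors of a connected network yields a polynomial $g_{\mathcal{N}}=p_1+ip_2$ ($p_1,p_2$ real polynomials), independent of order; value $\mathcal{V}_{\mathcal{N}}=\sqrt{p_1^2+p_2^2}$. $\mathcal{N}$ computes $f$ if $\mathcal{V}_{\mathcal{N}}(\alpha)>1/2$ when $f(\alpha)=1$ and $<1/2$ when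 $f(\alpha)=0$, for all $\alpha\in\{0,1\}^Y$. Carving width: a rooted carving decomposition of a multigraph $G=(V,E)$ is a pair $(T,\gamma)$ with $T$ a rooted binary tree and $\gamma$ a bijection from the leaves of $T$ to $V$; for a node $u$, $V(u)$ is the image under $\gamma$ of the leaves of the subtree rooted at $u$, and $E(V(u))$ is the set of edges with exactly one endpoint in $V(u)$. The width is $\max_u |E(V(u))|$, and the carving width of $G$ is the minimum width of such a decomposition. The carving width of $\mathcal{N}$ is that of $G(\mathcal{N})$. *)

(* Defs.v *)
(* MathComp, with finmap (index sets), multinomials (polynomials) and
   real-closed (R[i], the complex numbers when R is a realType). *)
From HB Require Import structures.
From mathcomp Require Import all_boot all_order all_algebra.
From mathcomp Require Import finmap mpoly complex reals.

Set Implicit Arguments.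
Unset Strict Implicit.
Unset Printing Implicit Defensive.

Import Order.TTheory GRing.Theory Num.Theory.
Local Open Scope ring_scope.

(* Self-loops are excluded: an edge has two distinct endpoints. *)
Record multigraph := Multigraph {
  vertex : finType;
  edge : finType;
  ends : edge -> {set vertex};
  card_ends : forall e, #|ends e| = 2%N
}.

Definition connected (G : multigraph) : Prop :=
  (0 < #|vertex G|)%N /\
  forall x y : vertex G,
    connect [rel u v | [exists e : edge G, (u \in ends e) && (v \in ends e)]]
      x y.

Definition boundary (G : multigraph) (S : {set vertex G}) : {set edge G} :=
  [set e | #|ends e :&: S| == 1%N].

(* Rooted binary trees in which every inner node has two children. *)
Inductive btree (V : Type) : Type :=
  | Leaf of V
  | Node of btree V & btree V.

Fixpoint leaves (V : Type) (t : btree V) : seq V :=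
  match t with
  | Leaf v => [:: v]
  | Node a b => leaves a ++ leaves b
  end.

(* One subtree for each node of [t]. *)
Fixpoint subtrees (V : Type) (t : btree V) : seq (btree V) :=
  t :: match t with
       | Leaf _ => [::]
       | Node a b => subtrees a ++ subtrees b
       end.

(* The labelling of the leaves is a bijection onto the vertices. *)
Definition carving_decomposition (G : multigraph) (t : btree (vertex G)) :
    Prop :=
  perm_eq (leaves t) (enum (vertex G)).

Definition decomposition_width (G : multigraph) (t : btree (vertex G)) : nat :=
  (\max_(u <- subtrees t) #|boundary [set v in leaves u]|)%N.

Definition has_carving_width (G : multigraph) (w : nat) : Prop :=
  (exists2 t : btree (vertex G),
     carving_decomposition t & decomposition_width t = w) /\
  (forall t : btree (vertex G),
     carving_decomposition t -> (w <= decomposition_width t)%N).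

(* The pair (a, b) stands for the operator |a><b|. *)
Definition Pi : finType := ('I_2 * 'I_2)%type.

(* The polynomial ring C[Y] is {mpoly R[i][#|Y|]}; the variable y in Y is
   'X_(enum_rank y). *)
Record tensor (R : realType) (Y : finType) := Tensor {
  idx : {fset nat};
  entry : {ffun {ffun idx -> Pi} -> {mpoly R[i][#|Y|]}}
}.

Section Networks.

Variables (R : realType) (Y : finType).

Definition tensor_rank (g : tensor R Y) : nat := #|` idx g|.

(* [msize] is the degree plus one, and 0 for the zero polynomial. *)
Definition tensor_degree (g : tensor R Y) : nat :=
  (\max_(s : {ffun idx g -> Pi}) (msize (entry g s)).-1)%N.

Definition is_Y_tensor (g : tensor R Y) : bool :=
  [exists s : {ffun idx g -> Pi}, [exists y : Y,
     has (fun m : 'X_{1..#|Y|} => 0 < m (enum_rank y))%N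
       (msupp (entry g s))]].

(* The value at [i] of an assignment on [I], with an irrelevant default
   outside [I]. *)
Definition assign (I : {fset nat}) (s : {ffun I -> Pi}) (i : nat) : Pi :=
  if insub i is Some j then s j else (ord0, ord0).

(* The assignment on [K] given by [s] on [I] and by [t] elsewhere. *)
Definition glue (K I J : {fset nat}) (s : {ffun I -> Pi}) (t : {ffun J -> Pi}) :
    {ffun K -> Pi} :=
  [ffun k : K => if val k \in I then assign s (val k) else assign t (val k)].

Definition symdiff (I J : {fset nat}) : {fset nat} :=
  ((I `\` J) `|` (J `\` I))%fset.

Definition contract (g h : tensor R Y) : tensor R Y :=
  @Tensor R Y (symdiff (idx g) (idx h))
    [ffun s => \sum_(t : {ffun (idx g `&` idx h)%fset -> Pi})
       entry g (glue (idx g) s t) * entry h (glue (idx h) s t)].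

Definition unit_tensor : tensor R Y := @Tensor R Y fset0 [ffun=> 1].

Definition indices (N : seq (tensor R Y)) : {fset nat} :=
  (\bigcup_(g <- N) idx g)%fset.

Record network := Network {
  tensors :> seq (tensor R Y);
  index_gt0 : forall i : nat, i \in indices tensors -> (0 < i)%N;
  index_twice : forall i : nat, i \in indices tensors ->
    count (fun g => i \in idx g) tensors = 2%N
}.

Definition network_rank (N : network) : nat :=
  (\max_(g <- N) tensor_rank g)%N.

Definition network_degree (N : network) : nat :=
  (\max_(g <- N) tensor_degree g)%N.

Definition index_ends (N : network) (i : indices N) : {set 'I_(size N)} :=
  [set v | val i \in idx (tnth (in_tuple N) v)].

Lemma card_index_ends (N : network) (i : indices N) : #|index_ends i| = 2%N.
Proof.
rewrite -(index_twice (valP i)) -sum1_count -sum1_card (big_tnth _ _ N).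
by apply: eq_bigl => v; rewrite inE.
Qed.

Definition network_graph (N : network) : multigraph :=
  Multigraph (@card_index_ends N).

(* The tensors are contracted in the order of the sequence; contracting with
   [unit_tensor] has no effect. *)
Definition contract_all (N : seq (tensor R Y)) : tensor R Y :=
  foldl contract unit_tensor N.

Lemma mem_indices (s : seq (tensor R Y)) (i : nat) :
  (i \in indices s) = has (fun g => i \in idx g) s.
Proof.
rewrite /indices; elim: s => [|g s IH]; first by rewrite big_nil inE.
by rewrite big_cons inE IH.
Qed.

Lemma idx_contract_all (N : network) : idx (contract_all N) = fset0.
Proof.
have par i s g0 : (i \in idx (foldl contract g0 s)) =
    (i \in idx g0) (+) odd (count (fun g => i \in idx g) s).
  elim: s g0 => [|g s IH] g0 /=; first by rewrite addbF.
  rewrite IH /= oddD oddb addbA; congr (_ (+) _).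
  by rewrite !inE; do 2!case: (i \in _).
apply/fsetP => i; rewrite /contract_all par !inE /=.
have [iN|iN] := boolP (i \in indices N); first by rewrite (index_twice iN).
by move: iN; rewrite mem_indices has_count -leqNgt leqn0 => /eqP ->.
Qed.

(* The only entry of the tensor of rank 0 obtained by contracting [N]: see
   [idx_contract_all]. *)
Definition network_poly (N : network) : {mpoly R[i][#|Y|]} :=
  entry (contract_all N) [ffun=> (ord0, ord0)].

Definition real_part (p : {mpoly R[i][#|Y|]}) : {mpoly R[#|Y|]} :=
  map_mpoly (@complex.Re R) p.

Definition imag_part (p : {mpoly R[i][#|Y|]}) : {mpoly R[#|Y|]} :=
  map_mpoly (@complex.Im R) p.

Definition point (a : {ffun Y -> bool}) (i : 'I_#|Y|) : R :=
  (a (enum_val i))%:R.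

Definition value (N : network) (a : {ffun Y -> bool}) : R :=
  Num.sqrt ((real_part (network_poly N)).@[point a] ^+ 2 +
            (imag_part (network_poly N)).@[point a] ^+ 2).

Definition computes (N : network) (f : {ffun Y -> bool} -> bool) : Prop :=
  forall a : {ffun Y -> bool},
    (f a = true -> value N a > 1 / 2) /\ (f a = false -> value N a < 1 / 2).

End Networks.

(* Main.v *)
(* Take a carving decomposition of width w and call a node heavy if its subtree
   contains a Y-tensor.  Keep the l Y-tensors, and along every maximal path of
   heavy nodes with only one heavy child contract all the tensors hanging off
   the path into one.  This leaves at most 3l - 1 tensors, and the set of
   vertices merged along a path is V(top) \ V(bottom), so that its boundary has
   at most 2w edges.  Contractions are associative as long as no index lies in
   three tensors, hence the merged network has the same polynomial. *)
Require Import Defs.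
From HB Require Import structures.
From mathcomp Require Import all_boot all_order all_algebra.
From mathcomp Require Import finmap mpoly complex reals.
From mathcomp Require boolp.

Set Implicit Arguments.
Unset Strict Implicit.
Unset Printing Implicit Defensive.

Import GRing.Theory.

(** * Total assignments and the algebra of contraction *)

Definition override (A : {fset nat}) (t : {ffun A -> Pi}) (x : nat -> Pi) :
    nat -> Pi :=
  fun i => if insub i is Some j then t j else x i.

Lemma override_in (A : {fset nat}) (t : {ffun A -> Pi}) x i (iA : i \in A) :
  override t x i = t (FSetSub iA).
Proof. by rewrite /override insubT. Qed.

Lemma override_val (A : {fset nat}) (t : {ffun A -> Pi}) x (i : A) :
  override t x (val i) = t i.
Proof. by rewrite /override valK. Qed.

Lemma override_notin (A : {fset nat}) (t : {ffun A -> Pi}) x i :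
  i \notin A -> override t x i = x i.
Proof. by move=> iA; rewrite /override insubN. Qed.

Definition restrict (A : {fset nat}) (x : nat -> Pi) : {ffun A -> Pi} :=
  [ffun i => x (val i)].
Arguments restrict : clear implicits.

(** The result is again a function of a total assignment, which supplies the values outside [A], so
    that such sums can be nested. *)
Definition sum_over (V : nmodType) (A : {fset nat}) (F : (nat -> Pi) -> V)
    (x : nat -> Pi) : V :=
  (\sum_(t : {ffun A -> Pi}) F (override t x))%R.

Lemma sum_overU (V : nmodType) (A B : {fset nat}) (F : (nat -> Pi) -> V) x :
  [disjoint A & B]%fset ->
  sum_over A (sum_over B F) x = sum_over (A `|` B)%fset F x.
Proof.
move=> /fdisjointP AB; rewrite /sum_over pair_big /=.
(* [h] and [k] are mutually inverse: on disjoint sets, a pair of assignments amounts to one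
   assignment on the union. *)
pose h (p : {ffun A -> Pi} * {ffun B -> Pi}) : {ffun (A `|` B)%fset -> Pi} :=
  restrict (A `|` B)%fset (override p.2 (override p.1 x)).
pose k (t : {ffun (A `|` B)%fset -> Pi}) :=
  (restrict A (override t x), restrict B (override t x)).
have hE p : override (h p) x = override p.2 (override p.1 x).
  rewrite /h; apply: boolp.funext => i.
  have [iAB|iAB] := boolP (i \in (A `|` B)%fset).
    by rewrite override_in ffunE.
  move: (iAB); rewrite in_fsetU negb_or => /andP[iA iB].
  by rewrite !override_notin.
rewrite (reindex h) /=; first by apply: eq_bigr => p _; rewrite hE.
exists k => [[s t]|t] _.
  congr pair; apply/ffunP => i; rewrite ffunE hE /=.
    by rewrite override_notin ?override_val// AB// valP.
  by rewrite override_val.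
apply/ffunP => i; rewrite ffunE /=.
have [iB|iB] := boolP (val i \in B).
  by rewrite override_in ffunE /= override_val.
have iA : val i \in A by have := valP i; rewrite in_fsetU (negPf iB) orbF.
rewrite override_notin// override_in ffunE /=.
by rewrite override_val.
Qed.

(** Evaluating at a total assignment turns tensors with different index sets into functions of one
    common argument and avoids casts between dependent types. *)
Definition valt (R : realType) (Y : finType) (g : tensor R Y) (x : nat -> Pi) :=
  entry g (restrict (idx g) x).

Lemma valt_override (R : realType) (Y : finType) (g : tensor R Y)
    (A : {fset nat}) (t : {ffun A -> Pi}) x :
  [disjoint idx g & A]%fset -> valt g (override t x) = valt g x.
Proof.
move=> /fdisjointP gA; congr (entry g _); apply/ffunP => i.
rewrite !ffunE override_notin //; apply: gA; exact: valP.
Qed.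

Lemma tensor_ext (R : realType) (Y : finType) (g h : tensor R Y) :
  idx g = idx h -> valt g =1 valt h -> g = h.
Proof.
case: g h => [I e] [J e'] /= IJ; case: J / IJ e' => e' eE.
congr Tensor; apply/ffunP => s.
have := eE (override s (fun=> (ord0, ord0))); rewrite /valt /=.
suff -> : restrict I (override s (fun=> (ord0, ord0))) = s by [].
by apply/ffunP => i; rewrite ffunE override_val.
Qed.

(** An index of [g] or [h] is either free, with its value read from [x], or shared, with its value
    read from the summation variable. Hence [glue] and [override] agree. *)
Lemma valt_contract (R : realType) (Y : finType) (g h : tensor R Y) x :
  valt (contract g h) x =
  sum_over (idx g `&` idx h)%fset (fun y => valt g y * valt h y)%R x.
Proof.
rewrite /valt /= ffunE; apply: eq_bigr => t _.
have glueE I (s := restrict (symdiff (idx g) (idx h)) x) :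
    (forall i, i \in I -> (i \in symdiff (idx g) (idx h)) ||
                          (i \in idx g `&` idx h)%fset) ->
    glue I s t = restrict I (override t x).
  move=> sub; apply/ffunP => i; rewrite !ffunE.
  have := sub _ (valP i); case: ifPn => [isd _|isd /= iI].
    rewrite override_notin; last first.
      by move: isd; rewrite !inE; do 2!case: (_ \in _).
    by rewrite /assign insubT ffunE.
  by rewrite /assign /override insubT.
rewrite !glueE// => i iI; rewrite !inE iI; by case: (_ \in _).
Qed.

Lemma contractC (R : realType) (Y : finType) (g h : tensor R Y) :
  contract g h = contract h g.
Proof.
apply: tensor_ext => [|x]; first by rewrite /= /symdiff fsetUC.
rewrite !valt_contract fsetIC; apply: eq_bigr => t _; exact: mulrC.
Qed.

Lemma contract1t (R : realType) (Y : finType) (g : tensor R Y) :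
  contract (unit_tensor R Y) g = g.
Proof.
apply: tensor_ext => [|x].
  by apply/fsetP => i; rewrite !inE; case: (_ \in _).
rewrite valt_contract /= fset0I /sum_over.
(* There is only one assignment on the empty index set. *)
rewrite (bigD1 (restrict fset0 x)) //= big1 => [|t]; last first.
  by case/eqP; apply/ffunP => i; have := valP i; rewrite inE.
rewrite addr0 !valt_override; try exact: fdisjointX0.
by rewrite {1}/valt ffunE mul1r.
Qed.

(* An index common to all three tensors would be summed over by the first
   contraction and left free by the second. *)
Lemma contractA (R : realType) (Y : finType) (g h k : tensor R Y) :
  (forall i, ~~ [&& i \in idx g, i \in idx h & i \in idx k]) ->
  contract g (contract h k) = contract (contract g h) k.
Proof.
move=> ghk; apply: tensor_ext => [|x].
  apply/fsetP => i; rewrite !inE.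
  by do 3!case: (_ \in _).
have dis A B : (forall i, ~~ ((i \in A) && (i \in B))) ->
    [disjoint A & B]%fset.
  by move=> AB; apply/fdisjointP => i iA; have := AB i; rewrite iA.
rewrite !valt_contract /=.
(* The outer factor contains no index summed by the inner contraction, so it moves under the inner
   sum. Both sides become iterated sums of the same triple product. *)
have -> : (fun y => valt g y * valt (contract h k) y)%R =
    sum_over (idx h `&` idx k)%fset
      (fun y => valt g y * valt h y * valt k y)%R.
  apply: boolp.funext => y; rewrite valt_contract mulr_sumr.
  apply: eq_bigr => t _; rewrite mulrA (valt_override (g := g))//.
  by apply: dis => i; rewrite !inE.
have -> : (fun y => valt (contract g h) y * valt k y)%R =
    sum_over (idx g `&` idx h)%fset
      (fun y => valt g y * valt h y * valt k y)%R.
  apply: boolp.funext => y; rewrite valt_contract mulr_suml.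
  apply: eq_bigr => t _; rewrite (valt_override (g := k))//.
  by apply: dis => i; have := ghk i; rewrite !inE; do 3!case: (_ \in _).
rewrite !sum_overU; first last.
- by apply: dis => i; have := ghk i; rewrite !inE; do 3!case: (_ \in _).
- by apply: dis => i; have := ghk i; rewrite !inE; do 3!case: (_ \in _).
(* Both unions consist of the indices lying in exactly two of the three tensors. *)
congr (sum_over _ _ x); apply/fsetP => i; have := ghk i; rewrite !inE.
by do 3!case: (_ \in _).
Qed.

(** * Contracting a sequence of tensors block by block *)

Lemma contract_all_rcons (R : realType) (Y : finType) (L : seq (tensor R Y)) g :
  contract_all (rcons L g) = contract (contract_all L) g.
Proof. by rewrite /contract_all -cats1 foldl_cat. Qed.

(** Symmetric difference adds memberships modulo 2. *)
Lemma mem_idx_contract_all (R : realType) (Y : finType) (L : seq (tensor R Y))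
    i :
  (i \in idx (contract_all L)) = odd (count (fun g => i \in idx g) L).
Proof.
elim/last_ind: L => [|L g IH] //.
rewrite contract_all_rcons -cats1 count_cat oddD -IH /= !inE addn0.
by do 2!case: (_ \in _).
Qed.

(** Groups of vertices are sequences, so that a partition is a sequence of sequences whose [flatten]
    is a permutation of all vertices. *)
Definition block (R : realType) (Y V : finType) (g : V -> tensor R Y)
    (s : seq V) : tensor R Y :=
  contract_all [seq g v | v <- s].

Definition incidence (R : realType) (Y V : finType) (g : V -> tensor R Y)
    (i : nat) (s : seq V) : nat :=
  count (fun v => i \in idx (g v)) s.

Lemma mem_idx_block (R : realType) (Y V : finType) (g : V -> tensor R Y) s i :
  (i \in idx (block g s)) = odd (incidence g i s).
Proof. by rewrite mem_idx_contract_all count_map. Qed.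

Lemma count_uniq_leq (V : finType) (p : pred V) (s : seq V) :
  uniq s -> (count p s <= count p (enum V))%N.
Proof.
move=> us; rewrite -!size_filter; apply: uniq_leq_size => [|v].
  exact: filter_uniq.
move=> vs; rewrite mem_filter mem_enum andbT.
by move: vs; rewrite mem_filter => /andP[].
Qed.

Lemma block1 (R : realType) (Y V : finType) (g : V -> tensor R Y) v :
  block g [:: v] = g v.
Proof. exact: contract1t. Qed.

(** Associativity is applied to each tensor appended to [s2]. An index of a block occurs in some
    tensor of it, so an index common to both blocks and to the new tensor would occur three
    times. *)
Lemma block_cat (R : realType) (Y V : finType) (g : V -> tensor R Y) s1 s2 :
  (forall i, incidence g i (enum V) <= 2)%N ->
  uniq (s1 ++ s2) -> block g (s1 ++ s2) = contract (block g s1) (block g s2).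
Proof.
move=> two; elim/last_ind: s2 => [|s2 v IH].
  by rewrite cats0 contractC contract1t.
rewrite -rcons_cat => us; rewrite {1}/block map_rcons contract_all_rcons.
rewrite -/(block g (s1 ++ s2)) IH; last first.
  by move: us; rewrite rcons_uniq => /andP[].
rewrite -contractA => [|i].
  by rewrite [block g (rcons s2 v)]/block map_rcons contract_all_rcons.
apply/negP; rewrite !mem_idx_block => /and3P[o1 o2 iv].
have := leq_trans (count_uniq_leq (fun v => i \in idx (g v)) us) (two i).
rewrite -cats1 !count_cat /= iv addn0; apply/negP; rewrite -ltnNge.
exact: leq_add (leq_add (odd_gt0 o1) (odd_gt0 o2)) (leqnn 1).
Qed.

(** The head of [s1] splits [s2] in two pieces; commutativity of [contract] exchanges these, which
    brings the head to the front. *)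
Lemma block_perm (R : realType) (Y V : finType) (g : V -> tensor R Y) s1 s2 :
  (forall i, incidence g i (enum V) <= 2)%N ->
  uniq s1 -> perm_eq s1 s2 -> block g s1 = block g s2.
Proof.
move=> two; elim: s1 s2 => [|v s1 IH] s2 us1 s12.
  by have := perm_size s12; case: s2 {s12}.
have us2 : uniq s2 by rewrite -(perm_uniq s12).
have vs2 : v \in s2 by rewrite -(perm_mem s12) mem_head.
case/splitPr: vs2 s12 us2 => t1 t2 s12 us2.
have s1t : perm_eq s1 (t2 ++ t1).
  by move: s12; rewrite perm_sym perm_catC /= perm_cons perm_sym.
rewrite (block_cat two us2) contractC -block_cat //; last by rewrite uniq_catC.
have us1v : uniq s1 by case/andP: us1.
have cons_block s : uniq (v :: s) ->
    block g (v :: s) = contract (block g [:: v]) (block g s).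
  exact: (block_cat (s1 := [:: v])).
rewrite cat_cons [RHS]cons_block; last by rewrite -cat_cons uniq_catC.
by rewrite cons_block // (IH _ us1v s1t).
Qed.

Lemma contract_all_blocks (R : realType) (Y V : finType)
    (g : V -> tensor R Y) ss :
  (forall i, incidence g i (enum V) <= 2)%N -> uniq (flatten ss) ->
  contract_all [seq block g s | s <- ss] = block g (flatten ss).
Proof.
move=> two; elim/last_ind: ss => [|ss s IH] //.
rewrite map_rcons contract_all_rcons flatten_rcons => us.
by rewrite block_cat // IH //; move: us; rewrite cat_uniq => /andP[].
Qed.

(** * Degrees of tensors without variables *)

Lemma mulr_msize_le1 n (F : idomainType) (p q : {mpoly F[n]}) :
  (msize p <= 1 -> msize q <= 1 -> msize (p * q)%R <= 1)%N.
Proof.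
have [->|p0] := eqVneq p 0%R; first by rewrite mul0r msize0.
have [->|q0] := eqVneq q 0%R; first by rewrite mulr0 msize0.
by rewrite msizeM //; case: (msize p) (msize q) => [|[|?]] [|[|?]].
Qed.

(** Since [msize] is one more than the degree, the bound 1 describes the constants, zero
    included. *)
Lemma tensor_degree_eq0P (R : realType) (Y : finType) (g : tensor R Y) :
  reflect (forall s, msize (entry g s) <= 1)%N (tensor_degree g == 0)%N.
Proof.
rewrite -leqn0; apply: (iffP (bigmax_leqP _ _ _)) => deg0 s; last first.
  by move=> _; have := deg0 s; case: (msize _) => [|[|?]].
by have := deg0 s isT; case: (msize _) => [|[|?]].
Qed.

(** A monomial of positive degree in some entry would contain a variable. *)
Lemma not_Y_tensor_degree (R : realType) (Y : finType) (g : tensor R Y) :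
  ~~ is_Y_tensor g -> tensor_degree g = 0%N.
Proof.
move=> gY; apply/eqP/tensor_degree_eq0P => s; rewrite msizeE.
apply/bigmax_leqP_seq => m ms _; rewrite ltnS leqn0 mdeg_eq0.
apply: contraNT gY => m0; apply/existsP; exists s.
have /existsP[i mi] : [exists i, m i != 0%N].
  apply: contraNT m0; rewrite negb_exists => /forallP m0.
  by apply/eqP/mnmP => i; rewrite mnm0E; apply/eqP; rewrite -[_ == _]negbK m0.
apply/existsP; exists (enum_val i); apply/hasP; exists m => //.
by rewrite enum_valK lt0n.
Qed.

Lemma contract_degree0 (R : realType) (Y : finType) (g h : tensor R Y) :
  tensor_degree g = 0%N -> tensor_degree h = 0%N ->
  tensor_degree (contract g h) = 0%N.
Proof.
move=> /eqP/tensor_degree_eq0P g0 /eqP/tensor_degree_eq0P h0.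
apply/eqP/tensor_degree_eq0P => s; rewrite ffunE.
apply: (big_ind (fun p : {mpoly _[_]} => msize p <= 1)%N) => [|p q p1 q1|t _].
- by rewrite msize0.
- by apply: leq_trans (msizeD_le _ _) _; rewrite geq_max p1.
- exact: mulr_msize_le1.
Qed.

Lemma block_degree0 (R : realType) (Y V : finType) (g : V -> tensor R Y) s :
  {in s, forall v, ~~ is_Y_tensor (g v)} -> tensor_degree (block g s) = 0%N.
Proof.
elim/last_ind: s => [|s v IH] sY.
  by apply/eqP/tensor_degree_eq0P => t; rewrite ffunE msize1.
rewrite /block map_rcons contract_all_rcons; apply: contract_degree0.
  by apply: IH => u us; apply: sY; rewrite mem_rcons inE us orbT.
by apply: not_Y_tensor_degree; apply: sY; rewrite mem_rcons mem_head.
Qed.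

(** * Parity of occurrence counts *)

Lemma leq_count_odd (cs : seq nat) : (count odd cs <= sumn cs)%N.
Proof.
by elim: cs => //= c cs IH; apply: leq_add => //; case: (c) => // n; case: odd.
Qed.

Lemma odd_count_odd (cs : seq nat) : odd (count odd cs) = odd (sumn cs).
Proof. by elim: cs => //= c cs IH; rewrite !oddD IH oddb. Qed.

(** The number of odd terms is positive, at most 2 and of the parity of 2. With [cs] the occurrences
    of an index in the blocks, an index that survives in one block lies in exactly two. *)
Lemma count_odd_eq2 (cs : seq nat) :
  sumn cs = 2%N -> has odd cs -> count odd cs = 2%N.
Proof.
move=> cs2; have := leq_count_odd cs; have := odd_count_odd cs.
by rewrite has_count cs2; case: (count odd cs) => [|[|[|?]]].
Qed.

Lemma leq_nth_sumn (cs : seq nat) k : (nth 0 cs k <= sumn cs)%N.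
Proof.
elim: cs k => [|c cs IH] [|k] //=; first exact: leq_addr.
exact: leq_trans (IH k) (leq_addl _ _).
Qed.

(** This bounds what two distinct blocks can contain together: at most two occurrences of an index,
    and at most one of a vertex. *)
Lemma leq_add_nth_sumn (cs : seq nat) j k :
  j != k -> (nth 0 cs j + nth 0 cs k <= sumn cs)%N.
Proof.
elim: cs j k => [|c cs IH] [|j] [|k] //= jk.
- by rewrite leq_add2l leq_nth_sumn.
- by rewrite addnC leq_add2l leq_nth_sumn.
- exact: leq_trans (IH j k jk) (leq_addl _ _).
Qed.

(** * Coarsening a carving decomposition *)

(** An edge with one end in [A :\: B] has one more end in [A] than in [B], and at most two in [A].
    So it has either no end in [B] and one in [A], or exactly one in [B]. *)
Lemma boundaryD (G : multigraph) (A B : {set vertex G}) : B \subset A ->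
  boundary (A :\: B) \subset boundary A :|: boundary B.
Proof.
move=> BA; apply/subsetP => e; rewrite !inE => /eqP eAB.
have eA : (#|ends e :&: A| <= 2)%N.
  by rewrite -(card_ends e) subset_leq_card ?subsetIl.
have := cardsID B (ends e :&: A).
rewrite -setIA (setIidPr BA) -setIDA eAB addn1 => eq.
by move: eA; rewrite -eq; case: #|_| => [|[|?]].
Qed.

Lemma boundary_leaves_leq (G : multigraph) (t : btree (vertex G)) :
  (#|boundary [set v in leaves t]| <= decomposition_width t)%N.
Proof.
by case: t => [v|a b]; rewrite /decomposition_width big_cons leq_maxl.
Qed.

Lemma decomposition_width_node (G : multigraph) (a b : btree (vertex G)) :
  decomposition_width (Node a b) =
  maxn #|boundary [set v in leaves (Node a b)]|
    (maxn (decomposition_width a) (decomposition_width b)).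
Proof. by rewrite /decomposition_width big_cons big_cat. Qed.

(** The three conditions serve connectedness, the degree and the rank of the merged network, in this
    order. *)
Definition coarse_block (G : multigraph) (p : pred (vertex G)) (w : nat)
    (s : seq (vertex G)) : Prop :=
  [/\ s != [::],
      (exists2 v, p v & s = [:: v]) \/ {in s, forall v, ~~ p v}
    & (#|boundary [set v in s]| <= 2 * w)%N].

(** This closes a path whose top has leaves [L] and whose bottom has leaves [flatten ss]: the
    vertices collected in [rest] form one more block, with boundary at most [w + w]. *)
Lemma coarse_block_rest (G : multigraph) (p : pred (vertex G)) (w : nat)
    (L rest : seq (vertex G)) (ss : seq (seq (vertex G))) :
  uniq L -> perm_eq (flatten ss ++ rest) L ->
  {in rest, forall v, ~~ p v} ->
  (#|boundary [set v in L]| <= w)%N ->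
  (#|boundary [set v in flatten ss]| <= w)%N ->
  {in ss, forall s, coarse_block p w s} ->
  exists ss', [/\ perm_eq (flatten ss') L,
                  {in ss', forall s, coarse_block p w s}
                & (size ss' <= (size ss).+1)%N].
Proof.
move=> uL pL restp bL bss ssP.
(* An empty [rest] yields no block, since blocks must be nonempty. *)
have [rest0|rest_neq0] := eqVneq rest [::].
  by exists ss; split=> //; move: pL; rewrite rest0 cats0.
exists (rcons ss rest); split; first by rewrite flatten_rcons.
  move=> s; rewrite mem_rcons inE => /predU1P[->|/ssP//].
  split=> //; first by right.
  have -> : [set v in rest] = [set v in L] :\: [set v in flatten ss].
    apply/setP => v; rewrite !inE -(perm_mem pL) mem_cat.
    move: uL; rewrite -(perm_uniq pL) cat_uniq => /and3P[_ /hasPn dis _].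
    have [vr|] := boolP (v \in rest); last by rewrite orbF andNb.
    by rewrite orbT andbT (dis v vr).
  apply: leq_trans (subset_leq_card (boundaryD _)) _.
    by apply/subsetP => v; rewrite !inE -(perm_mem pL) mem_cat => ->.
  apply: leq_trans (leq_card_setU _ _) _.
  by rewrite mul2n -addnn leq_add.
by rewrite size_rcons.
Qed.

(* In the tree spanned by the [p]-leaves, every maximal path of nodes having
   only one child above a [p]-leaf contributes the single block [rest], whose
   boundary lies in those of the two ends of the path. *)
Lemma coarsen_tree (G : multigraph) (p : pred (vertex G)) (w : nat)
    (t : btree (vertex G)) :
  uniq (leaves t) -> (decomposition_width t <= w)%N -> has p (leaves t) ->
  exists ss rest,
    [/\ perm_eq (flatten ss ++ rest) (leaves t),
        {in rest, forall v, ~~ p v},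
        (#|boundary [set v in flatten ss]| <= w)%N,
        {in ss, forall s, coarse_block p w s}
      & (size ss + 2 <= 3 * count p (leaves t))%N].
Proof.
elim: t => [v|a IHa b IHb].
  move=> _ wd; rewrite /= orbF => pv; exists [:: [:: v]], [::].
  have bv : (#|boundary [set u in [:: v]]| <= w)%N.
    exact: leq_trans (boundary_leaves_leq (Leaf v)) wd.
  split=> //; last by rewrite pv.
  move=> s; rewrite inE => /eqP->; split=> //; first by left; exists v.
  by rewrite (leq_trans bv) // leq_pmull.
rewrite /= cat_uniq has_cat decomposition_width_node !geq_max count_cat.
move=> /and3P[ua dis ub] /and3P[bab wa wb].
have none c : ~~ has p (leaves c) -> {in leaves c, forall v, ~~ p v}.
  by move=> /hasPn.
have bl (c : btree (vertex G)) (wc : (decomposition_width c <= w)%N) :=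
  leq_trans (boundary_leaves_leq c) wc.
have [pa|pa] := boolP (has p (leaves a));
  have [pb|pb] := boolP (has p (leaves b)); rewrite //= => _.
(* With two heavy children, the paths below end here: both rests are closed, and a new path starts
   with an empty rest. *)
- have [ssa [ra [perma rap bssa ssaP sza]]] := IHa ua wa pa.
  have [ssb [rb [permb rbp bssb ssbP szb]]] := IHb ub wb pb.
  have [ca [permca caP szca]] :=
    coarse_block_rest ua perma rap (bl a wa) bssa ssaP.
  have [cb [permcb cbP szcb]] :=
    coarse_block_rest ub permb rbp (bl b wb) bssb ssbP.
  have permc : perm_eq (flatten (ca ++ cb)) (leaves a ++ leaves b).
    by rewrite flatten_cat perm_cat.
  exists (ca ++ cb), [::]; split=> //; first by rewrite cats0.
  + rewrite (_ : [set v in _] = [set v in leaves (Node a b)]) //.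
    by apply/setP => v; rewrite !inE (perm_mem permc).
  + by move=> s; rewrite mem_cat => /orP[/caP|/cbP].
  (* With [c] heavy leaves there are at most [3c - 2] blocks before closing and [3c - 1] after it;
     and [(3a - 1) + (3b - 1) = 3(a + b) - 2]. *)
  + rewrite size_cat mulnDr (leq_trans _ (leq_add sza szb)) // addnACA.
    have := leq_add szca szcb; rewrite addSn addnS -addn2 -(leq_add2r 2).
    by rewrite (addnA _ 2 2).
(* With one heavy child, the path continues and the leaves of the light child join the rest. The
   bottom of the path is unchanged. *)
- have [ss [r [perms rp bss ssP sz]]] := IHa ua wa pa.
  exists ss, (r ++ leaves b); split=> //.
  + by rewrite catA perm_cat2r.
  + by move=> v; rewrite mem_cat => /orP[/rp//|]; apply: none.
  + by rewrite (leq_trans sz) // leq_mul2l leq_addr orbT.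
- have [ss [r [perms rp bss ssP sz]]] := IHb ub wb pb.
  exists ss, (r ++ leaves a); split=> //.
  + by rewrite catA perm_sym perm_catC perm_cat2r perm_sym.
  + by move=> v; rewrite mem_cat => /orP[/rp//|]; apply: none.
  + by rewrite (leq_trans sz) // leq_mul2l leq_addl orbT.
Qed.

(** * Vertices of a network and occurrences of an index *)

Definition node_tensor (R : realType) (Y : finType) (N : seq (tensor R Y))
    (v : 'I_(size N)) : tensor R Y :=
  tnth (in_tuple N) v.
Arguments node_tensor {R Y} N v.

Lemma map_node_tensor (R : realType) (Y : finType) (N : seq (tensor R Y)) :
  [seq node_tensor N v | v <- enum 'I_(size N)] = N.
Proof. exact: (map_tnth_enum (in_tuple N)). Qed.

Lemma count_node_tensor (R : realType) (Y : finType) (N : seq (tensor R Y))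
    (a : pred (tensor R Y)) :
  count (fun v => a (node_tensor N v)) (enum 'I_(size N)) = count a N.
Proof. by rewrite -[in RHS](map_node_tensor N) count_map. Qed.

Lemma mem_indices_incidence (R : realType) (Y : finType) (N : network R Y) i :
  (0 < incidence (node_tensor N) i (enum 'I_(size N)))%N = (i \in indices N).
Proof.
by rewrite /incidence (count_node_tensor N (fun g => i \in idx g)) mem_indices
   has_count.
Qed.

Lemma incidence_network (R : realType) (Y : finType) (N : network R Y) i :
  i \in indices N -> incidence (node_tensor N) i (enum 'I_(size N)) = 2%N.
Proof.
by move=> /index_twice <-; exact: (count_node_tensor N (fun g => i \in idx g)).
Qed.

Lemma incidence_leq2 (R : realType) (Y : finType) (N : network R Y) i :
  (incidence (node_tensor N) i (enum 'I_(size N)) <= 2)%N.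
Proof.
have [/incidence_network->//|] := boolP (i \in indices N).
by rewrite -mem_indices_incidence -leqNgt leqn0 => /eqP->.
Qed.

(** * The network obtained by contracting blocks *)

Lemma incidence_flatten (R : realType) (Y V : finType) (g : V -> tensor R Y)
    i ss :
  incidence g i (flatten ss) = sumn [seq incidence g i s | s <- ss].
Proof. exact: count_flatten. Qed.

Lemma mem_indices_blocks (R : realType) (Y : finType) (N : network R Y)
    (ss : seq (seq 'I_(size N))) i :
  perm_eq (flatten ss) (enum 'I_(size N)) ->
  i \in indices [seq block (node_tensor N) s | s <- ss] -> i \in indices N.
Proof.
move=> ssN; rewrite mem_indices has_map => /hasP[s sss /=].
rewrite mem_idx_block => /odd_gt0; rewrite -mem_indices_incidence -!has_count.
case/hasP => v vs iv; apply/hasP; exists v; last by [].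
exact: mem_enum.
Qed.

(** A block keeps [i] exactly when [i] occurs in it an odd number of times, and these numbers add up
    to 2 over all blocks. *)
Lemma index_twice_blocks (R : realType) (Y : finType) (N : network R Y)
    (ss : seq (seq 'I_(size N))) i :
  perm_eq (flatten ss) (enum 'I_(size N)) ->
  i \in indices [seq block (node_tensor N) s | s <- ss] ->
  count (fun g => i \in idx g) [seq block (node_tensor N) s | s <- ss] = 2%N.
Proof.
move=> ssN iss.
have eqc : count (fun g => i \in idx g) [seq block (node_tensor N) s | s <- ss]
    = count odd [seq incidence (node_tensor N) i s | s <- ss].
  by rewrite !count_map; apply: eq_count => s /=; rewrite mem_idx_block.
rewrite eqc count_odd_eq2 //.
  rewrite -incidence_flatten -(incidence_network (mem_indices_blocks ssN iss)).
  exact/permP.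
by rewrite has_count -eqc -has_count -mem_indices.
Qed.

Definition block_network (R : realType) (Y : finType) (N : network R Y)
    (ss : seq (seq 'I_(size N)))
    (ssN : perm_eq (flatten ss) (enum 'I_(size N))) : network R Y :=
  @Network R Y [seq block (node_tensor N) s | s <- ss]
    (fun i iss => index_gt0 (mem_indices_blocks ssN iss))
    (fun i iss => index_twice_blocks ssN iss).

(** An index kept by the block has odd incidence at most 2, hence 1, so its edge has exactly one end
    in [s]. *)
Lemma idx_block_leq_boundary (R : realType) (Y : finType) (N : network R Y)
    (s : seq 'I_(size N)) :
  uniq s ->
  (#|` idx (block (node_tensor N) s)| <=
   #|boundary (G := network_graph N) [set v in s]|)%N.
Proof.
move=> us; rewrite [leqRHS]cardE -(size_map val).
apply: uniq_leq_size (fset_uniq _) _ => i iB.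
have oi : odd (incidence (node_tensor N) i s) by rewrite -mem_idx_block.
have le2 : (incidence (node_tensor N) i s <= 2)%N.
  exact: leq_trans (count_uniq_leq _ us) (incidence_leq2 _ _).
have iN : i \in indices N.
  rewrite -mem_indices_incidence.
  exact: leq_trans (odd_gt0 oi) (count_uniq_leq _ us).
apply/mapP; exists (FSetSub iN) => //; rewrite mem_enum inE.
suff -> : #|ends (m := network_graph N) (FSetSub iN) :&: [set v in s]| =
    incidence (node_tensor N) i s.
  by case: (incidence _ _ _) oi le2 => [|[|[|?]]].
rewrite /incidence -size_filter -(card_uniqP (filter_uniq _ us)).
by apply: eq_card => v; rewrite !inE mem_filter.
Qed.

(** A path of the old graph is projected to blocks. An edge joining distinct blocks uses up both
    occurrences of its index, one in each, so this index survives in both. *)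
Lemma connected_block_network (R : realType) (Y : finType) (N : network R Y)
    (ss : seq (seq 'I_(size N)))
    (ssN : perm_eq (flatten ss) (enum 'I_(size N))) :
  {in ss, forall s, s != [::]} -> connected (network_graph N) ->
  connected (network_graph (block_network ssN)).
Proof.
move=> ss_neq0 [N_gt0 N_conn].
have size_ss : size (block_network ssN) = size ss by rewrite /= size_map.
pose B (j : nat) := nth [::] ss j.
have tensor_at (j : 'I_(size (block_network ssN))) :
    tnth (in_tuple (block_network ssN)) j = block (node_tensor N) (B j).
  rewrite (tnth_nth (unit_tensor R Y)) /= (nth_map [::]) //.
  by rewrite -size_ss.
(* Out of range, [B m] is the empty block, whose count matches the default [0]. *)
have count_nth (c : seq _ -> nat) m :
    c [::] = 0%N -> c (B m) = nth 0%N [seq c s | s <- ss] m.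
  have [m_lt|m_ge] := ltnP m (size ss); first by rewrite (nth_map [::]).
  by rewrite /B !nth_default ?size_map.
have in_block v : exists j : 'I_(size (block_network ssN)), v \in B j.
  have : v \in flatten ss by rewrite (perm_mem ssN) mem_enum.
  case/flattenP => s /(nthP [::])[j j_lt <-] vs.
  by rewrite -size_ss in j_lt; exists (Ordinal j_lt).
have step (u v : 'I_(size N)) (j k : 'I_(size (block_network ssN))) :
    u \in B j -> v \in B k ->
    [exists e : edge (network_graph N), (u \in ends e) && (v \in ends e)] ->
    j != k ->
    [exists e : edge (network_graph (block_network ssN)),
      (j \in ends e) && (k \in ends e)].
  move=> uj vk /existsP[[i iN]]; rewrite !inE /= => /andP[iu iv] jk.
  pose c s := incidence (node_tensor N) i s.
  have cj : (0 < c (B j))%N by rewrite -has_count; apply/hasP; exists u.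
  have ck : (0 < c (B k))%N by rewrite -has_count; apply/hasP; exists v.
  have : (c (B j) + c (B k) <= 2)%N.
    rewrite !(count_nth c) // (leq_trans (leq_add_nth_sumn _ jk)) //.
    rewrite -incidence_flatten -(incidence_network iN).
    by rewrite eq_leq //; apply/permP.
  move=> cjk.
  have [oj ok] : odd (c (B j)) /\ odd (c (B k)).
    by move: (c (B j)) (c (B k)) cj ck cjk => [|[|?]] [|[|?]]; rewrite ?addnS.
  have iN' : i \in indices (block_network ssN).
    rewrite mem_indices has_map; apply/hasP; exists (B j).
      by apply: mem_nth; rewrite -size_ss.
    by rewrite /= mem_idx_block.
  apply/existsP; exists (FSetSub iN'); rewrite !inE /= !tensor_at.
  by rewrite !mem_idx_block oj.
split.
  case/card_gt0P: N_gt0 => v _; have [j _] := in_block v.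
  by apply/card_gt0P; exists j.
move=> j k.
have nonempty (m : 'I_(size (block_network ssN))) : exists v, v \in B m.
  have : B m != [::] by apply/ss_neq0/mem_nth; rewrite -size_ss.
  by case: (B m) => [|v s] // _; exists v; apply: mem_head.
have [u uj] := nonempty j; have [v vk] := nonempty k.
have /connectP[p] := N_conn u v.
elim: p => [|x p IH] in u j uj * => /=.
  move=> _ vu; rewrite vu in vk.
  have [->|jk] := eqVneq j k; first exact: connect0.
  (* Here [u] lies in both blocks; two distinct blocks would make it occur twice in the
     duplicate-free [flatten ss]. *)
  have := leq_add_nth_sumn [seq count_mem u s | s <- ss] jk.
  rewrite -!(count_nth (count_mem u)) // -count_flatten.
  rewrite (count_uniq_mem u (s := flatten ss)); last first.
    by rewrite (perm_uniq ssN) enum_uniq.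
  rewrite leqNgt => /negP[]; apply: leq_ltn_trans (leq_b1 _) _.
  by apply: (@leq_add 1 1); rewrite -has_count has_pred1.
case/andP => ux xp vE; have [m xm] := in_block x.
have mk := IH x m xm xp vE; have [->//|jm] := eqVneq j m.
by apply: connect_trans (connect1 _) mk; apply: step ux _.
Qed.

(** * Invariance of the polynomial, and the theorem *)

Lemma network_poly_valt (R : realType) (Y : finType) (N : network R Y) :
  network_poly N = valt (contract_all N) (fun=> (ord0, ord0)).
Proof. by []. Qed.

(** Through [valt] the argument no longer depends on the index set of the contracted tensor, so
    equalities of tensors can be rewritten. The blocks flatten to a permutation of the original
    order of contraction. *)
Lemma network_poly_block (R : realType) (Y : finType) (N : network R Y)
    (ss : seq (seq 'I_(size N)))
    (ssN : perm_eq (flatten ss) (enum 'I_(size N))) :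
  network_poly (block_network ssN) = network_poly N.
Proof.
have uss : uniq (flatten ss) by rewrite (perm_uniq ssN) enum_uniq.
rewrite !network_poly_valt /= contract_all_blocks //; last first.
  exact: incidence_leq2.
rewrite (block_perm _ uss ssN); last exact: incidence_leq2.
by rewrite /block map_node_tensor.
Qed.

Theorem theorem1 (R : realType) (Y : finType) (Y_neq0 : (0 < #|Y|)%N)
    (N : network R Y) (w d l : nat) (f : {ffun Y -> bool} -> bool)
    (N_conn : connected (network_graph N))
    (N_cw : has_carving_width (network_graph N) w)
    (N_deg : network_degree N = d)
    (N_f : computes N f)
    (N_l : count (@is_Y_tensor R Y) N = l)
    (l_ge : (#|Y| <= l)%N) :
  exists N' : network R Y,
    [/\ connected (network_graph N'),
        computes N' f,
        (size N' <= 4 * l * (w + 1))%N,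
        (network_rank N' <= 2 * w)%N
      & network_degree N' = d].
Proof.
have l_gt0 : (0 < l)%N := leq_trans Y_neq0 l_ge.
have [[t t_carv tw] _] := N_cw.
pose p : pred (vertex (network_graph N)) :=
  fun v => is_Y_tensor (node_tensor N v).
have ut : uniq (leaves t) by rewrite (perm_uniq t_carv) enum_uniq.
have pl : count p (leaves t) = l.
  rewrite -N_l -(count_node_tensor N (@is_Y_tensor R Y)).
  exact/permP.
have tw' : (decomposition_width t <= w)%N by rewrite tw.
have hp : has p (leaves t) by rewrite has_count pl.
have [ss0 [rest [perm0 restp b0 ss0P sz0]]] := coarsen_tree ut tw' hp.
(* The last path, ending at the root, is closed. *)
have [ss [perm_ss ssP sz]] := coarse_block_rest ut perm0 restp
  (leq_trans (boundary_leaves_leq t) tw') b0 ss0P.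
have ssN : perm_eq (flatten ss) (enum 'I_(size N)) := perm_trans perm_ss t_carv.
have uss s : s \in ss -> uniq s.
  have : uniq (flatten ss) by rewrite (perm_uniq ssN) enum_uniq.
  move=> + sss; case/splitPr: sss => s1 s2.
  by rewrite flatten_cat cat_uniq /= cat_uniq => /and3P[_ _ /and3P[]].
exists (block_network ssN); split.
- by apply: connected_block_network => // s /ssP[].
- by move=> a; rewrite /value network_poly_block; apply: N_f.
(* There are at most [3 * l - 1] blocks, and [w + 1] is positive. *)
- rewrite size_map (leq_trans sz) //.
  have : (size ss0 + 2 <= 4 * l)%N.
    by rewrite (leq_trans sz0) // pl leq_mul2r orbT.
  rewrite addn2 => /ltnW/leq_trans; apply.
  by rewrite leq_pmulr // addn1.
- rewrite /network_rank big_map; apply/bigmax_leqP_seq => s sss _.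
  have [_ _ bs] := ssP s sss.
  by apply: leq_trans bs; apply: idx_block_leq_boundary; apply: uss.
(* A block is a single original tensor or has degree 0, whence one inequality. Conversely, every
   Y-tensor is a block by itself and all other tensors have degree 0. *)
- rewrite -N_deg /network_degree -[in RHS](map_node_tensor N) !big_map.
  apply/eqP; rewrite eqn_leq; apply/andP; split.
    apply/bigmax_leqP_seq => s sss _; have [_ [[v pv ->]|np] _] := ssP s sss.
      by rewrite block1 (leq_bigmax_seq v) ?mem_enum.
    by rewrite block_degree0.
  apply/bigmax_leqP_seq => v _ _.
  have [pv|/not_Y_tensor_degree->//] := boolP (is_Y_tensor (node_tensor N v)).
  have : v \in flatten ss by rewrite (perm_mem ssN) mem_enum.
  case/flattenP => s sss vs.
  have [_ [[u pu su]|np] _] := ssP s sss; last first.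
    by move: (np v vs); rewrite /p pv.
  move: vs; rewrite su inE => /eqP ->.
  by rewrite -(block1 (node_tensor N) u) -su (leq_bigmax_seq s).
Qed.
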